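(* The natural extension $\tilde F$ of the Farey map is a factor of the first return map $\bar P:\bar X^*\to\bar X$ of the geodesic flow on $T_1\mathcal{M}$ to the cross section $\bar X$. Specifically, in the coordinates $(U,W,\epsilon)$ on $\bar X$, for $(U,W,\epsilon)\in\bar X^*=(0,1)^2\times\{\pm1\}$, $$\bar{P}(U,W,\epsilon)=\begin{cases}(\tilde{F}(U,W),\epsilon)&\text{if }0<U\leq\frac{1}{2},\\ (\tilde{F}(U,W),-\epsilon)&\text{if }\frac{1}{2}<U<1,\end{cases}$$ so that, if $\bar\pi_{\bar X}:\bar X\to[0,1]^2$ is defined by $\bar\pi_{\bar X}(U,W,\epsilon)=(U,W)$, then $\bar\pi_{\bar X}\circ\bar P=\tilde F\circ\bar\pi_{\bar X}$ on $\bar X^*$. Also, the first return time function $\bar r$ is given by $$\bar r(U,W,\epsilon)=-\frac12\log\big((1-U)(1-W)\big).$$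
   Context: $\mathbb{H}=\{x+iy:x,y\in\mathbb{R},y>0\}$ is the upper half plane with the hyperbolic metric $ds^2=(dx^2+dy^2)/y^2$; $\mathrm{PSL}_2(\mathbb{R})$ acts on it isometrically by linear fractional transformations. The modular surface is $\mathcal{M}=\mathrm{PSL}_2(\mathbb{Z})\backslash\mathbb{H}$. $T_1\mathbb{H}$ is the unit tangent bundle, $T_1\mathcal{M}$ is the unit tangent bundle of $\mathcal M$, i.e. $\mathrm{PSL}_2(\mathbb{Z})\backslash T_1\mathbb{H}$, and $g_t$ ($t\in\mathbb{R}$) is the (unit speed) geodesic flow on $T_1\mathbb{H}$, which descends to $T_1\mathcal{M}$. For $(z,v)\in T_1\mathbb{H}$, $\alpha(z,v)=\lim_{t\to-\infty}g_t(z,v)$ and $\beta(z,v)=\lim_{t\to+\infty}g_t(z,v)$ denote the backward and forward endpoints in $\mathbb{R}\cup\{\infty\}$ of the oriented geodesic through $(z,v)$. The cross section is $$\bar X=\{(z,v)\in T_1\mathcal{M}:\alpha(z,v)\neq0,\ |\beta(z,v)|\ge1,\ z\in i\mathbb{R}\},$$ meaning the set of classes in $T_1\mathcal{M}$ of vectors $(z,v)\in T_1\mathbb{H}$ with base point $z$ on the positive imaginary axis and real endpoints $\alpha(z,v)\ne0$, $|\beta(z,v)|\ge1$ (equivalently, the set of all nonvertical unit tangent vectors based on the positive imaginary axis, projected to $T_1\mathcal M$). It is parameterized by the coordinates $(U,W,\epsilon)\in(0,1]\times(0,1)\times\{\pm1\}$, where $$U=|\beta|^{-1},\qquad W=(1+|\alpha|)^{-1},\qquad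 \epsilon=\operatorname{sign}(\beta),$$ and $\bar X$ is identified with $(0,1]\times(0,1)\times\{\pm1\}$ by this parameterization. (Here $\alpha$ and $\beta$ have opposite signs, and $z$ is the point where the geodesic from $\alpha$ to $\beta$ crosses the imaginary axis.) The first return map is $\bar P(z,v)=g_{\bar r(z,v)}(z,v)$ with $\bar r(z,v)=\min\{s>0:g_s(z,v)\in\bar X\}$, and $\bar X^*=(0,1)^2\times\{\pm1\}$ is the set of points of $\bar X$ on which $\bar P$ is defined. The natural extension $\tilde F:[0,1]^2\to[0,1]^2$ of the Farey map is $\tilde F(x,y)=\left(\frac{x}{1-x},\frac{y}{1+y}\right)$ if $0\le x\le\frac12$ and $\tilde F(x,y)=\left(\frac{1-x}{x},\frac{1}{1+y}\right)$ if $\frac12<x\le1$. *)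

(* Defs.v *)
From HB Require Import structures.
From mathcomp Require Import all_boot all_order all_algebra.
From mathcomp Require Import all_classical all_reals all_analysis.
From mathcomp Require Import complex.
Set Implicit Arguments.
Unset Strict Implicit.
Unset Printing Implicit Defensive.
Import Order.TTheory GRing.Theory Num.Theory numFieldNormedType.Exports.
Local Open Scope classical_set_scope.
Local Open Scope ring_scope.
Local Open Scope complex_scope.
Local Open Scope quotient_scope.

Section UnitTangentBundle.
Variable R : realType.

(* Tangent vectors of H are pairs (z, v) of complex numbers.  The metric is
   (dx^2 + dy^2) / y^2, so v has length one at z when |v| = Im z. *)
Definition unit_tangent (p : R[i] * R[i]) : bool :=
  (0 < complex.Im p.1) && (`|p.2| == (complex.Im p.1)%:C).

Record T1H := MkT1H { zv :> R[i] * R[i]; _ : unit_tangent zv }.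
HB.instance Definition _ := [isSub for zv].
HB.instance Definition _ := [Choice of T1H by <:].

Definition basept (p : T1H) : R[i] := (zv p).1.

Definition denom (A : 'M[R]_2) (z : R[i]) : R[i] := (A 1 0)%:C * z + (A 1 1)%:C.

(* The linear fractional transformation of A with \det A = 1, together with
   its derivative (c z + d)^-2 acting on tangent vectors. *)
Definition mobius (A : 'M[R]_2) (p : R[i] * R[i]) : R[i] * R[i] :=
  (((A 0 0)%:C * p.1 + (A 0 1)%:C) / denom A p.1, p.2 / denom A p.1 ^+ 2).

(* SL2(Z) and PSL2(Z) have the same orbits. *)
Definition modular_rel (p q : T1H) : bool :=
  `[< exists2 A : 'M[int]_2, \det A = 1
      & zv q = mobius (map_mx intr A) (zv p) >].

Lemma mobius1 p : mobius 1%:M p = p.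
Proof.
case: p => z v; rewrite /mobius /denom !mxE /=.
by rewrite mul1r mul0r addr0 add0r !divr1 expr1n divr1.
Qed.

Lemma denom_neq0 (A : 'M[R]_2) z :
  \det A = 1 -> 0 < complex.Im z -> denom A z != 0.
Proof.
move=> dA; case: z => x y /= y0; rewrite /denom eq_complex /=.
rewrite !mul0r subr0 !addr0.
apply/negP => /andP[/eqP h1 /eqP h2].
move: dA; rewrite (expand_det_row _ 1) !big_ord_recl big_ord0 /cofactor.
have c0 : A 1 0 = 0 by move/eqP: h2; rewrite mulf_eq0 (gt_eqF y0) orbF => /eqP.
have d0 : A 1 1 = 0 by move: h1; rewrite c0 mul0r add0r.
have -> : lift ord0 ord0 = 1 :> 'I_2 by apply/val_inj.
rewrite c0 d0 !mul0r !addr0 => /eqP; by rewrite eq_sym oner_eq0.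
Qed.

Lemma mobiusM (A B : 'M[R]_2) p : denom B p.1 != 0 ->
  mobius (A *m B) p = mobius A (mobius B p).
Proof.
case: p => z v /= Bz; rewrite /mobius /=.
have E i : (A i 0)%:C * (((B 0 0)%:C * z + (B 0 1)%:C) / denom B z) + (A i 1)%:C =
   (((A *m B) i 0)%:C * z + ((A *m B) i 1)%:C) / denom B z.
  rewrite !mxE !big_ord_recl !big_ord0 !addr0.
  have -> : lift ord0 ord0 = 1 :> 'I_2 by apply/val_inj.
  apply: (mulIf Bz); rewrite mulrDl mulrA !mulfVK // /denom.
  rewrite !(rmorphD, rmorphM) /= !mulrDl !mulrDr !mulrA.
  by rewrite -!addrA; congr (_ + _); rewrite addrCA.
have D : denom A (((B 0 0)%:C * z + (B 0 1)%:C) / denom B z) =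
   denom (A *m B) z / denom B z by exact: E.
rewrite D E; congr (_, _).
  by rewrite invf_div mulrA mulfVK.
by rewrite exprMn exprVn invf_div [RHS]mulrA mulfVK // expf_neq0.
Qed.

Lemma T1H_Im (p : T1H) : 0 < complex.Im (zv p).1.
Proof. by case: p => p /= /andP[]. Qed.

Lemma modular_denom (A : 'M[int]_2) (p : T1H) :
  \det A = 1 -> denom (map_mx intr A) (zv p).1 != 0.
Proof.
by move=> dA; apply: denom_neq0 (T1H_Im p); rewrite det_map_mx dA.
Qed.

Lemma modular_refl : reflexive modular_rel.
Proof.
by move=> p; apply/asboolP; exists 1%:M; rewrite ?det1 // map_mx1 mobius1.
Qed.

Lemma modular_sym : symmetric modular_rel.
Proof.
suff H p q : modular_rel p q -> modular_rel q p.
  by move=> p q; apply/idP/idP; exact: H.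
move=> /asboolP[A dA qE]; apply/asboolP; exists (invmx A).
  by rewrite det_inv dA invr1.
rewrite qE -mobiusM ?modular_denom // -map_mxM mulVmx ?map_mx1 ?mobius1 //.
by rewrite unitmxE dA unitr1.
Qed.

Lemma modular_trans : transitive modular_rel.
Proof.
move=> q p r /asboolP[A dA qE] /asboolP[B dB rE]; apply/asboolP.
exists (B *m A); first by rewrite det_mulmx dA dB mulr1.
by rewrite rE qE -mobiusM ?modular_denom // -map_mxM.
Qed.

Canonical modular_equiv :=
  EquivRel modular_rel modular_refl modular_sym modular_trans.

Definition T1M := {eq_quot modular_equiv}.

Definition T1M_class (p : T1H) : T1M := \pi_({eq_quot modular_equiv}) p.

Lemma up_subproof (s : R) : 0 < s -> unit_tangent (s *i, s *i).
Proof.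
move=> s0; rewrite /unit_tangent /= s0 /= normc_def /=.
by rewrite expr0n add0r sqrtr_sqr gtr0_norm.
Qed.

(* The upward unit vector at i * e^t. *)
Definition up (t : R) : T1H := MkT1H (up_subproof (expR_gt0 t)).

(* The geodesic flow commutes with isometries and moves up 0 to up t.  As
   PSL2(R) acts simply transitively on T1H, this determines it: the point q
   below exists and is unique. *)
Definition flow (t : R) (p : T1H) : T1H :=
  xget p [set q | exists A : 'M[R]_2,
    [/\ \det A = 1, zv p = mobius A (up 0) & zv q = mobius A (up t)]].

(* R \cup {oo} is the boundary of H in the Riemann sphere, where None is oo. *)
Definition sphere : topologicalType := one_point_compactification (R[i]^o).

Definition to_sphere (z : R[i]) : sphere := Some z.

Definition alpha (p : T1H) : sphere :=
  lim (to_sphere (basept (flow t p)) @[t --> -oo]).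
Definition beta (p : T1H) : sphere :=
  lim (to_sphere (basept (flow t p)) @[t --> +oo]).

(* The choice of representative is immaterial: flow commutes with mobius. *)
Definition flowM (t : R) (x : T1M) : T1M := T1M_class (flow t (repr x)).

(* The representatives in T1H of the points of the cross section. *)
Definition Xlift : set T1H := [set p | complex.Re (basept p) = 0 /\
  exists a b : R, [/\ alpha p = to_sphere a%:C, beta p = to_sphere b%:C,
                      a != 0 & 1 <= `|b|]].

Definition Xbar : set T1M := T1M_class @` Xlift.

Definition is_first_return (x : T1M) (s : R) : Prop :=
  [/\ 0 < s, Xbar (flowM s x) &
      forall s' : R, 0 < s' -> Xbar (flowM s' x) -> s <= s'].

Definition rbar (x : T1M) : R := xget 0 (is_first_return x).
Definition Pbar (x : T1M) : T1M := flowM (rbar x) x.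

(* The domain of Pbar: the points that do return to Xbar, at a least time. *)
Definition Xstar : set T1M :=
  [set x | Xbar x /\ exists s : R, is_first_return x s].

Definition real_endpoint (w : sphere) : R :=
  if w is Some z then complex.Re z else 0.

(* (U, W, epsilon); meaningful on Xlift, where both endpoints are real. *)
Definition coords (p : T1H) : R * R * int :=
  (`|real_endpoint (beta p)|^-1, (1 + `|real_endpoint (alpha p)|)^-1,
   sgz (real_endpoint (beta p))).

Definition box : set (R * R * int) :=
  [set q | [/\ 0 < q.1.1 <= 1, 0 < q.1.2 < 1 & q.2 = 1 \/ q.2 = -1]].

Definition box_star : set (R * R * int) := [set q | box q /\ q.1.1 < 1].

(* The point of the cross section with given coordinates in box. *)
Definition Theta (q : R * R * int) : T1M :=
  T1M_class (xget (up 0) [set p | Xlift p /\ coords p = q]).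

(* The coordinates of a point of Xbar.  The vectors of Xlift with |beta| = 1
   are interchanged by z |-> -1/z, so (1, W, e) and (1, 1 - W, -e) are
   coordinates of the same point of Xbar, while a point with U < 1 has a single
   coordinate triple.  When U = 1 we take the triple with W <= 1/2; only
   (1, 1/2, 1) and (1, 1/2, -1) are then left to an arbitrary choice. *)
Definition coordsM (x : T1M) : R * R * int :=
  xget (0, 0, 0) [set q | [/\ box q, Theta q = x &
                              q.1.1 = 1 -> q.1.2 <= 2^-1]].

Definition piXbar (x : T1M) : R * R := (coordsM x).1.

Definition Ftilde (p : R * R) : R * R :=
  if p.1 <= 2^-1 then (p.1 / (1 - p.1), p.2 / (1 + p.2))
  else ((1 - p.1) / p.1, 1 / (1 + p.2)).

End UnitTangentBundle.

Arguments Xbar {R}.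
Arguments Xlift {R}.
Arguments Xstar {R}.
Arguments box {R}.
Arguments box_star {R}.

(* Main.v *)
(* A unit vector is g(i, i) for a matrix g of determinant 1, unique up to sign.
   The flow multiplies g on the right by diag(e^(t/2), e^(-t/2)), the modular
   group acts on the left, and the ratios of the entries in the columns of g are
   beta and alpha.  The flow line of a vector of the cross section is back in
   the section when it crosses some Farey edge M^-1(iR), M in SL2(Z).  If
   M = [m, n; k, l] then f(x) = (m x + n)(k x + l) has discriminant 1 and
   vanishes at the ends of the edge, and the crossing time t satisfies
   e^(2t) = (f(alpha) / alpha) / (f(beta) / beta).  For t > 0 an elementary
   estimate on forms of discriminant 1 bounds this below by its value for the
   edge from epsilon to oo, which is 1 / ((1 - U)(1 - W)); this edge is
   crossed if and only if U < 1.  Translating it back to the imaginary axis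
   gives the branches of the Farey map. *)
Require Import Defs.
From HB Require Import structures.
From mathcomp Require Import all_boot all_order all_algebra.
From mathcomp Require Import all_classical all_reals all_analysis.
From mathcomp Require Import complex.
From mathcomp Require Import ring lra zify.
Set Implicit Arguments.
Unset Strict Implicit.
Unset Printing Implicit Defensive.
Import Order.TTheory GRing.Theory Num.Theory numFieldNormedType.Exports.
Local Open Scope classical_set_scope.
Local Open Scope ring_scope.

(** * Limits in the Riemann sphere *)

Section ComplexTopology.
Local Open Scope complex_scope.
Variable R : realType.

Lemma normc_le_sum (z : R[i]) : `|z| <= (`|complex.Re z| + `|complex.Im z|)%:C.
Proof.
case: z => x y; rewrite normc_def /= lecR.
rewrite -[leRHS]ger0_norm ?addr_ge0 // -sqrtr_sqr ler_wsqrtr //.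
by rewrite sqrrD !real_normK ?num_real // lerD2r lerDl mulrn_wge0 ?mulr_ge0.
Qed.

Lemma normc_ge_Im (z : R[i]) : `|complex.Im z|%:C <= `|z|.
Proof.
case: z => x y; rewrite normc_def /= lecR -sqrtr_sqr ler_wsqrtr //.
by rewrite lerDr sqr_ge0.
Qed.

(** The norm of [R[i]] takes values in [R[i]], so radii of balls are complex; the partial order
    there makes the positive ones real. *)
Lemma pos_complexE (e : R[i]) : 0 < e -> exists2 r : R, 0 < r & e = r%:C.
Proof.
by case: e => x y; rewrite ltcE /= => /andP[/eqP -> x0]; exists x.
Qed.

Lemma Im_continuous : continuous (@complex.Im R : R[i]^o -> R).
Proof.
move=> z; apply/(@cvgrPdist_lt _ _ _ _ (nbhs_filter z)) => e e0.
apply/nbhs_ballP; exists e%:C; first by rewrite /= ltcR.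
move=> w; rewrite -ball_normE /= => zw.
have := le_lt_trans (normc_ge_Im _) zw; rewrite ltcR.
by case: z {zw} => ? ?; case: w.
Qed.

Lemma complex_continuous :
  continuous ((fun u => u.1 +i* u.2) : R * R -> R[i]^o).
Proof.
case=> x y; apply/cvg_ballP => e /pos_complexE[r r0 ->].
apply/(@nbhs_ballP _ (R * R)%type); exists (r / 2); first by rewrite /= divr_gt0.
case=> x' y' [] /=; rewrite -!ball_normE /= => xx' yy'.
apply: le_lt_trans (normc_le_sum _) _; rewrite ltcR /=.
by rewrite [ltRHS](splitr r) ltrD.
Qed.

Lemma locally_compact_complex : locally_compact [set: R[i]^o].
Proof.
move=> [x y] _; rewrite withinET.
pose K := (fun u => u.1 +i* u.2 : R[i]^o) @`
  (`[x - 1, x + 1] `*` `[y - 1, y + 1]).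
have cK : compact K.
  apply: continuous_compact; first exact/continuous_subspaceT/complex_continuous.
  by apply: compact_setX; exact: segment_compact.
exists K; last by split => //; exact: compact_closed (@norm_hausdorff _ _) cK.
apply/nbhs_ballP; exists 1; first exact: ltr01.
move=> [x' y']; rewrite -ball_normE /= => zw.
have h1 := le_lt_trans (normc_ge_Re _) zw.
have h2 := le_lt_trans (normc_ge_Im _) zw.
move: h1 h2; rewrite !ltcR /= !ltr_norml => /andP[? ?] /andP[? ?].
by exists (x', y') => //=; rewrite !in_itv /=; split; apply/andP; split; lra.
Qed.

(** Uniqueness of limits, without which [lim] in [alpha] and [beta] could not be computed from a
    convergence statement. *)
Lemma sphere_hausdorff : hausdorff_space (sphere R).
Proof.
apply: one_point_compactification_hausdorff; first exact: locally_compact_complex.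
exact: norm_hausdorff.
Qed.

Lemma lim_sphere_fin (F : set_system R) (FF : ProperFilter F)
    (f : R -> R[i]) (l : R[i]) (g : R -> R) :
  g @ F --> 0 -> (forall t, `|f t - l| <= (g t)%:C) ->
  lim (to_sphere (f t) @[t --> F]) = to_sphere l.
Proof.
move=> g0 fl; apply: cvg_lim; first exact: sphere_hausdorff.
apply: (@cvg_comp _ _ _ (f : R -> R[i]^o) Some F (nbhs (l : R[i]^o))) => //.
apply/cvgrPdistC_lt => e /pos_complexE[r r0 ->].
move/cvgrPdistC_lt: g0 => /(_ _ r0); apply: filterS => t.
rewrite subr0 => /(le_lt_trans (ler_norm _)); rewrite -ltcR.
exact: le_lt_trans.
Qed.

(** Neighbourhoods of infinity contain complements of compact sets, and the imaginary part is
    bounded on a compact set. *)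
Lemma lim_sphere_oo (F : set_system R) (FF : ProperFilter F) (f : R -> R[i]) :
  complex.Im (f t) @[t --> F] --> +oo ->
  lim (to_sphere (f t) @[t --> F]) = None.
Proof.
move=> /cvgryPgt g0; apply: cvg_lim; first exact: sphere_hausdorff.
move=> /= U [K [cK _] KU].
have : compact ((@complex.Im R : R[i]^o -> R) @` K).
  apply: continuous_compact => //.
  exact/continuous_subspaceT/Im_continuous.
move=> /compact_bounded [M [Mr MK]].
have := g0 (M + 1); apply: filterS => t ft.
apply: KU; left; exists (f t) => // Kft.
have := MK (M + 1); rewrite ltrDl ltr01 => /(_ isT (complex.Im (f t))) /=.
move=> /(_ (ex_intro2 _ _ _ Kft erefl)) /(le_trans (ler_norm _)).
by rewrite leNgt ft.
Qed.

Lemma expR_cvgNy : @expR R t @[t --> -oo] --> 0.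
Proof. by apply/cvgNy_compNP; exact: cvgr_expR. Qed.

End ComplexTopology.

(** * Unit tangent vectors as matrices of determinant 1 up to sign *)

Section Frames.
Local Open Scope complex_scope.
Variable R : realType.
Implicit Types (A B : 'M[R]_2) (p q : T1H R) (s t : R).

Definition mx2 {T : pzRingType} (a b c d : T) : 'M[T]_2 :=
  \matrix_(i, j) if i == 0 then (if j == 0 then a else b)
                 else (if j == 0 then c else d).

Lemma mx2E {T : pzRingType} (a b c d : T) :
  (mx2 a b c d 0 0 = a) * (mx2 a b c d 0 1 = b) *
  (mx2 a b c d 1 0 = c) * (mx2 a b c d 1 1 = d).
Proof. by rewrite !mxE. Qed.

Lemma eq_mx2 {T : pzRingType} (A B : 'M[T]_2) :
  A 0 0 = B 0 0 -> A 0 1 = B 0 1 -> A 1 0 = B 1 0 -> A 1 1 = B 1 1 -> A = B.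
Proof.
have ordE (i : 'I_2) : i = 0 \/ i = 1.
  by case: i => -[|[|//]] i; [left | right]; exact: val_inj.
move=> ? ? ? ?; apply/matrixP => i j.
by case: (ordE i) => ->; case: (ordE j) => ->.
Qed.

Lemma det_mx2 {T : comPzRingType} (A : 'M[T]_2) :
  \det A = A 0 0 * A 1 1 - A 0 1 * A 1 0.
Proof.
rewrite (expand_det_row _ 0) !big_ord_recl big_ord0 /cofactor !det_mx11 !mxE /=.
rewrite addr0 !expr0 mul1r.
have -> : lift ord0 ord0 = 1 :> 'I_2 by exact: val_inj.
have -> : lift 1 ord0 = 0 :> 'I_2 by exact: val_inj.
by rewrite expr1 mulN1r mulrN.
Qed.

Lemma mulmx2E {T : pzRingType} (A B : 'M[T]_2) i j :
  (A *m B) i j = A i 0 * B 0 j + A i 1 * B 1 j.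
Proof.
rewrite !mxE !big_ord_recl big_ord0 addr0.
by have -> : lift ord0 ord0 = 1 :> 'I_2 by exact: val_inj.
Qed.

Lemma mobius_up A t : mobius A (zv (up t)) =
  let w := A 1 1 +i* (A 1 0 * expR t) in
  ((A 0 1 +i* (A 0 0 * expR t)) / w, (expR t)*i / w ^+ 2).
Proof.
by rewrite /mobius /denom /=; simpc.
Qed.

Lemma den_neq0 A t : \det A = 1 -> A 1 1 +i* (A 1 0 * expR t) != 0.
Proof.
move=> dA; have := denom_neq0 (z := (expR t)*i) dA (expR_gt0 t).
by rewrite /denom; simpc.
Qed.

(* The isometry A carries the upward unit vector at i to p. *)
Definition frame p A := \det A = 1 /\ zv p = mobius A (zv (up (0 : R))).

Lemma frame_inj p q A : frame p A -> frame q A -> p = q.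
Proof. by move=> [_ pA] [_ qA]; apply: val_inj; rewrite /= pA qA. Qed.

(** With [w] the denominator at i, determinant 1 makes both the height of the image and the length
    of its vector equal to 1 / |w|^2. *)
Lemma frame_ex A : \det A = 1 -> exists p, frame p A.
Proof.
move=> dA; suff h : unit_tangent (mobius A (zv (up (0 : R)))) by exists (MkT1H h).
have w0 := den_neq0 0 dA.
rewrite expR0 mulr1 in w0.
rewrite mobius_up /unit_tangent expR0 !mulr1; cbv zeta; cbn [fst snd].
set w := A 1 1 +i* A 1 0 in w0 *.
have nw : `|w| ^+ 2 = (A 1 1 ^+ 2 + A 1 0 ^+ 2)%:C by rewrite -add_Re2_Im2.
have w1 : 0 < A 1 1 ^+ 2 + A 1 0 ^+ 2.
  by rewrite -ltcR -nw exprn_gt0 // normr_gt0.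
have -> : complex.Im ((A 0 1 +i* A 0 0) / w) = (A 1 1 ^+ 2 + A 1 0 ^+ 2)^-1.
  rewrite /= -[RHS]mul1r -dA det_mx2; ring.
rewrite invr_gt0 w1 /= normrM normfV normrX nw.
rewrite normc_def /= expr0n expr1n add0r sqrtr1 mul1r.
by rewrite -[X in X == _]fmorphV.
Qed.

(** The vector is i / w^2, which fixes the bottom row [w] up to sign; the base point then fixes the
    top row. *)
Lemma frame_unique p A B : frame p A -> frame p B -> B = A \/ B = - A.
Proof.
move=> [dA pA] [dB pB]; move: pB; rewrite pA !mobius_up.
have := den_neq0 0 dA; have := den_neq0 0 dB; rewrite /= expR0 !mulr1.
set w' := B 1 1 +i* _; set w := A 1 1 +i* _ => w'0 w0 wE.
have E1 := congr1 fst wE; have E2 := congr1 snd wE.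
cbn [fst snd] in E1, E2.
have i0 : 'i%C != 0 :> R[i] by rewrite eq_complex /= oner_eq0 andbF.
have : w' ^+ 2 == w ^+ 2.
  by move: E2 => /(mulfI i0) /invr_inj ->.
rewrite eqf_sqr => /orP[/eqP ww|/eqP ww].
- left; move: E1; rewrite ww => /(mulIf _) E.
  move: (E (invr_neq0 w0)) ww; rewrite /w /w' => -[? ?] [? ?].
  exact: eq_mx2.
right; move: E1; rewrite ww invrN mulrN -mulNr => /(mulIf _) E.
move: (E (invr_neq0 w0)) ww; rewrite /w /w' => -[e1 e2] [? ?].
by apply: eq_mx2; rewrite [RHS]mxE ?e1 ?e2 ?opprK.
Qed.

Lemma mobiusN A (u : R[i] * R[i]) : mobius (- A) u = mobius A u.
Proof.
rewrite /mobius /denom !mxE !rmorphN /= !mulNr -!opprD sqrrN.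
by rewrite invrN mulrNN.
Qed.

Lemma frame_exists p : exists A, frame p A.
Proof.
case: p => -[z v] pP; case/andP: (pP) => /= y0 /eqP nv.
have v0 : v != 0 by rewrite -normr_gt0 nv ltcR.
(* The bottom row must satisfy i / w^2 = v, and the top row is then z w. *)
set w := sqrtc ('i%C / v).
have w2 : w ^+ 2 = 'i%C / v by rewrite sqr_sqrtc.
have i1 : `|'i%C : R[i]| = 1.
  by rewrite normc_def /= expr0n expr1n add0r sqrtr1.
have nw : (complex.Re w) ^+ 2 + (complex.Im w) ^+ 2 = (complex.Im z)^-1.
  apply: complexI; rewrite add_Re2_Im2 -normrX w2 normrM normfV nv i1 mul1r.
  by rewrite -fmorphV.
have w0 : w != 0.
  by rewrite -sqrf_eq0 w2 mulf_neq0 ?invr_neq0 // -normr_gt0 i1.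
exists (mx2 (complex.Im (z * w)) (complex.Re (z * w)) (complex.Im w) (complex.Re w)).
split.
  rewrite det_mx2 !mx2E; apply: (mulIf (lt0r_neq0 (y0 : 0 < complex.Im z))).
  case: (z) (w) y0 nw => x y [c d] /= y0 nw.
  transitivity ((y * (c ^+ 2 + d ^+ 2)) * y); first by ring.
  by rewrite nw mulfV ?gt_eqF.
rewrite mobius_up !mx2E /= expR0 !mulr1.
have eC (u : R[i]) : complex.Re u +i* complex.Im u = u by case: u.
rewrite !eC mulfK // w2 invf_div mulrA mulrAC mulfV ?mul1r //.
by rewrite -normr_gt0 i1.
Qed.

Definition diag_flow t : 'M[R]_2 := mx2 (expR (t / 2)) 0 0 (expR (- (t / 2))).

Lemma det_diag_flow t : \det (diag_flow t) = 1.
Proof. by rewrite det_mx2 !mx2E mul0r subr0 expRN mulfV // gt_eqF ?expR_gt0. Qed.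

Lemma mobius_diag_flow t : mobius (diag_flow t) (zv (up (0 : R))) = zv (up t).
Proof.
rewrite mobius_up !mx2E mul0r expR0 mulr1 /=.
have e0 : expR (- (t / 2)) != 0 :> R by rewrite gt_eqF ?expR_gt0.
have E : expR t = expR (t / 2) / expR (- (t / 2)) :> R.
  by rewrite -expRB opprK -splitr.
have E2 : expR t = (expR (- (t / 2)) ^+ 2)^-1 :> R.
  by rewrite -expRM_natl -expRN mulrN opprK mulrC divfK // pnatr_eq0.
congr pair; rewrite ?complexr0 -?rmorphXn -fmorphV /=; simpc.
  by rewrite E.
by rewrite E2.
Qed.

(** Two frames of a vector differ by a sign, which [mobius] ignores, so the point picked by [xget]
    in [flow] does not depend on the matrix. The default is never reached, since [A] itself provides
    a candidate. *)
Lemma frame_flow p A t : frame p A -> frame (flow t p) (A *m diag_flow t).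
Proof.
move=> pA; have [dA zA] := pA.
have dAt : \det (A *m diag_flow t) = 1 by rewrite det_mulmx dA det_diag_flow mulr1.
have E B : \det B = 1 ->
    mobius (B *m diag_flow t) (zv (up (0 : R))) = mobius B (zv (up t)).
  move=> dB; rewrite mobiusM ?mobius_diag_flow //.
  by apply: denom_neq0; [exact: det_diag_flow | exact: expR_gt0].
split => //; rewrite E // /flow.
have [q [dq zq]] := frame_ex dAt.
case: xgetP => [r _ [B [dB zB ->]]|/(_ q)[]]; last first.
  by exists A; split; rewrite // zq E.
by have [->|->] := frame_unique pA (conj dB zB); rewrite ?mobiusN.
Qed.

Lemma frame_modular p q A : frame p A -> modular_rel p q <->
  exists2 M : 'M[int]_2, \det M = 1 & frame q (map_mx intr M *m A).
Proof.
move=> [dA zA].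
have E (M : 'M[int]_2) :
    mobius (map_mx intr M *m A) (zv (up (0 : R))) = mobius (map_mx intr M) (zv p).
  by rewrite zA mobiusM //; apply: denom_neq0; [exact: dA | exact: expR_gt0].
split=> [/asboolP[M dM zq]|[M dM [_ zq]]].
  by exists M => //; split; rewrite ?E // det_mulmx det_map_mx dM dA mulr1.
by apply/asboolP; exists M; rewrite // zq E.
Qed.

Lemma frame_basept p A : frame p A ->
  basept p = (A 0 1 +i* A 0 0) / (A 1 1 +i* A 1 0).
Proof. by move=> [_ zA]; rewrite /basept zA mobius_up /= expR0 !mulr1. Qed.

Lemma frame_basept_flow p A t : frame p A ->
  basept (flow t p) =
  (A 0 1 +i* (A 0 0 * expR t)) / (A 1 1 +i* (A 1 0 * expR t)).
Proof.
move=> [dA zA]; have [_] := frame_flow t (conj dA zA).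
rewrite mobiusM ?mobius_diag_flow.
  by rewrite /basept => ->; rewrite mobius_up.
by apply: denom_neq0; [exact: det_diag_flow | exact: expR_gt0].
Qed.

Lemma frame_Re_basept p A : frame p A ->
  complex.Re (basept p) = 0 <-> A 0 0 * A 1 0 + A 0 1 * A 1 1 = 0.
Proof.
move=> pA; have [dA _] := pA; have := den_neq0 0 dA.
rewrite (frame_basept pA) expR0 mulr1 -normr_gt0 => w0.
have w1 : A 1 1 ^+ 2 + A 1 0 ^+ 2 != 0.
  by rewrite gt_eqF // -ltcR (add_Re2_Im2 (_ +i* _)) exprn_gt0.
have -> : complex.Re ((A 0 1 +i* A 0 0) / (A 1 1 +i* A 1 0)) =
    (A 0 0 * A 1 0 + A 0 1 * A 1 1) / (A 1 1 ^+ 2 + A 1 0 ^+ 2).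
  by rewrite /=; field.
by split=> [/eqP|->]; rewrite ?mul0r // mulf_eq0 invr_eq0 (negPf w1) orbF => /eqP.
Qed.

End Frames.

(** * Endpoints of geodesics and the cross section in terms of frames *)

Section Endpoints.
Local Open Scope complex_scope.
Variable R : realType.
Implicit Types (A B : 'M[R]_2) (p q : T1H R).

Lemma expR_scale_cvgy (k : R) : 0 < k -> expR t * k @[t --> +oo] --> +oo.
Proof.
move=> k0; apply/cvgryPgt => M; near=> t.
rewrite -ltr_pdivrMr //; apply: lt_le_trans (expR_ge1Dx t).
rewrite (@lt_trans _ _ t) ?ltrDr //; near: t.
by apply: nbhs_pinfty_gt; rewrite num_real.
Unshelve. all: by end_near. Qed.

Lemma Im_basept_flow p A t : frame p A ->
  complex.Im (basept (flow t p)) =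
  expR t / (A 1 1 ^+ 2 + (A 1 0 * expR t) ^+ 2).
Proof.
move=> pA; have [dA _] := pA; rewrite (frame_basept_flow t pA) /=.
by rewrite -[X in _ = X / _]mul1r -dA det_mx2; ring.
Qed.

Lemma normc_real (x : R) : `|x%:C| = `|x|%:C.
Proof. by rewrite normc_def /= expr0n addr0 sqrtr_sqr. Qed.

Lemma normc_im (x : R) : `|x *i| = `|x|%:C.
Proof. by rewrite normc_def /= expr0n add0r sqrtr_sqr. Qed.

Lemma frame_alpha p A : frame p A -> alpha p =
  if A 1 1 == 0 then None else to_sphere (A 0 1 / A 1 1)%:C.
Proof.
move=> pA; have [dA _] := pA; case: eqVneq => [d0|d0].
  have c0 : A 1 0 != 0.
    apply: contra_eq_neq dA => c0.
    by rewrite det_mx2 c0 d0 !mulr0 subr0 eq_sym oner_eq0.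
  apply: lim_sphere_oo; apply/cvgNy_compNP.
  have k0 : 0 < (A 1 0 ^+ 2)^-1 by rewrite invr_gt0 exprn_even_gt0.
  apply: cvg_trans (expR_scale_cvgy k0); apply: near_eq_cvg; near=> t => /=.
  by rewrite (Im_basept_flow _ pA) d0 expRN; field; rewrite c0 gt_eqF ?expR_gt0.
(* By determinant 1 the distance to the limit is e^t / (|w| |A11|), and |w| is at least its real
   part |A11|. *)
apply: (@lim_sphere_fin _ _ _ _ _ (fun t => expR t * (A 1 1 ^+ 2)^-1)).
  rewrite -[X in _ --> X](mul0r (A 1 1 ^+ 2)^-1).
  by apply: cvgM; [exact: expR_cvgNy | exact: cvg_cst].
move=> t; rewrite (frame_basept_flow t pA).
have := den_neq0 t dA; set w := A 1 1 +i* _ => w0.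
have dC0 : (A 1 1)%:C != 0 by rewrite (inj_eq (@complexI _)).
have -> : (A 0 1 +i* (A 0 0 * expR t)) / w - (A 0 1 / A 1 1)%:C =
    (expR t)*i / (w * (A 1 1)%:C).
  rewrite rmorphM fmorphV -mulNr addf_div //; congr (_ / _).
  rewrite /w; simpc; congr Complex.
  by rewrite -[RHS]mul1r -dA det_mx2; ring.
rewrite normrM normfV normrM normc_im normc_real (gtr0_norm (expR_gt0 t)).
rewrite -(real_normK (num_real (A 1 1))) expr2.
rewrite rmorphM ler_wpM2l ?lecR ?expR_ge0 // fmorphV rmorphM.
rewrite lef_pV2 ?posrE ?mulr_gt0 ?normr_gt0 ?ltcR ?normr_gt0 //.
by rewrite ler_wpM2r ?(normc_ge_Re w) ?lecR.
Unshelve. all: by end_near. Qed.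

Lemma frame_beta p A : frame p A -> beta p =
  if A 1 0 == 0 then None else to_sphere (A 0 0 / A 1 0)%:C.
Proof.
move=> pA; have [dA _] := pA; case: eqVneq => [c0|c0].
  have d0 : A 1 1 != 0.
    apply: contra_eq_neq dA => d0.
    by rewrite det_mx2 c0 d0 !mulr0 subr0 eq_sym oner_eq0.
  apply: lim_sphere_oo.
  have k0 : 0 < (A 1 1 ^+ 2)^-1 by rewrite invr_gt0 exprn_even_gt0.
  apply: cvg_trans (expR_scale_cvgy k0); apply: near_eq_cvg; near=> t => /=.
  by rewrite (Im_basept_flow _ pA) c0 mul0r expr0n addr0.
(* Here the distance is 1 / (|w| |A10|), and |w| is at least its imaginary part |A10| e^t. *)
apply: (@lim_sphere_fin _ _ _ _ _ (fun t => expR (- t) * (A 1 0 ^+ 2)^-1)).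
  rewrite -[X in _ --> X](mul0r (A 1 0 ^+ 2)^-1).
  by apply: cvgM; [exact: cvgr_expR | exact: cvg_cst].
move=> t; rewrite (frame_basept_flow t pA).
have := den_neq0 t dA; set w := A 1 1 +i* _ => w0.
have cC0 : (A 1 0)%:C != 0 by rewrite (inj_eq (@complexI _)).
have -> : (A 0 1 +i* (A 0 0 * expR t)) / w - (A 0 0 / A 1 0)%:C =
    (-1)%:C / (w * (A 1 0)%:C).
  rewrite rmorphM fmorphV -mulNr addf_div //; congr (_ / _).
  rewrite /w; simpc; congr Complex; last by ring.
  by rewrite -dA det_mx2; ring.
rewrite normrM normfV normrM !normc_real normrN1 mul1r expRN -invfM.
rewrite -(real_normK (num_real (A 1 0))) expr2 mulrA fmorphV rmorphM.
rewrite lef_pV2 ?posrE ?mulr_gt0 ?normr_gt0 ?ltcR ?mulr_gt0 ?normr_gt0 ?expR_gt0 //.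
rewrite ler_wpM2r ?ler0c ?normr_ge0 //; apply: le_trans (normc_ge_Im _).
by rewrite lecR /w /= normrM (gtr0_norm (expR_gt0 t)) mulrC.
Unshelve. all: by end_near. Qed.

Lemma XliftP p A : frame p A -> Xlift p <->
  [/\ A 0 0 * A 1 0 + A 0 1 * A 1 1 = 0, A 0 1 != 0, A 1 0 != 0, A 1 1 != 0 &
      `|A 1 0| <= `|A 0 0|].
Proof.
move=> pA; rewrite /Xlift /= (frame_alpha pA) (frame_beta pA).
have S0 z : None <> to_sphere z :> sphere R by [].
have SI (x y : R) : to_sphere x%:C = to_sphere y%:C -> x = y by case.
split=> [[/(frame_Re_basept pA) h [a [b]]]|[h b0 c0 d0 ca]].
  case: eqVneq => [_ [/S0//]|d0]; case: eqVneq => [_ [_ /S0//]|c0].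
  move=> [/SI <- /SI <-]; rewrite mulf_eq0 invr_eq0 (negPf d0) orbF => b0.
  by rewrite normf_div ler_pdivlMr ?normr_gt0 // mul1r.
split; first exact/(frame_Re_basept pA).
exists (A 0 1 / A 1 1), (A 0 0 / A 1 0); rewrite (negPf c0) (negPf d0).
split => //; first by rewrite mulf_neq0 ?invr_eq0.
by rewrite normf_div ler_pdivlMr ?normr_gt0 // mul1r.
Qed.

Lemma coords_frame p A : frame p A -> A 1 0 != 0 -> A 1 1 != 0 ->
  coords p =
    (`|A 0 0 / A 1 0|^-1, (1 + `|A 0 1 / A 1 1|)^-1, sgz (A 0 0 / A 1 0)).
Proof.
move=> pA c0 d0.
by rewrite /coords (frame_alpha pA) (frame_beta pA) (negPf c0) (negPf d0).
Qed.

End Endpoints.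

(** * A lower bound for forms of discriminant 1 *)

Section FormBound.
Variable R : realFieldType.

(** The common end of both cases below: the scale [m] cancels from the bounds on [D] and [N]. It is
    1 when the leading coefficient vanishes and n + 1 otherwise. *)
Lemma form_bound_aux (m D N X x T : R) : 0 < m -> 0 < x -> 0 < T ->
  D <= (1 - X^-1) * m -> m * (1 + x^-1) <= N -> T * D = N ->
  1 <= (1 - X^-1) * (x / (1 + x)) * T.
Proof.
move=> m0 x0 T0 Dm mN TD.
have x1 : 0 < 1 + x by rewrite addr_gt0.
have H : m * (1 + x^-1) <= (1 - X^-1) * T * m.
  apply: le_trans mN _; rewrite -TD mulrAC mulrC ler_wpM2r ?(ltW T0) //.
have : 1 + x^-1 <= (1 - X^-1) * T by rewrite -(ler_pM2r m0) mulrC.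
have -> : 1 + x^-1 = (1 + x) / x by field; rewrite gt_eqF.
rewrite ler_pdivrMr // => h.
by rewrite mulrAC mulrA ler_pdivlMr // mul1r.
Qed.

(** The case B = 2n + 1 > 0, with the outer coefficients negated to be nonnegative. If A = 0 then n
    = 0 and C >= 1. Otherwise X lies between the roots n / A and (n + 1) / A, and X >= 1 forces A <=
    n < C. *)
Lemma form_bound_reduced (n A C : int) (X x T : R) :
  0 <= n -> 0 <= A -> 0 <= C -> n * (n + 1) = A * C -> 0 < A + C ->
  1 <= X -> 0 < x -> 0 < T ->
  0 < (2 * n + 1)%:~R - (A%:~R * X + C%:~R / X) ->
  T * ((2 * n + 1)%:~R - (A%:~R * X + C%:~R / X)) =
    (2 * n + 1)%:~R + (A%:~R * x + C%:~R / x) ->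
  1 < X /\ 1 <= (1 - X^-1) * (x / (1 + x)) * T.
Proof.
move=> n0 A0 C0 nAC AC X1 x0 T0.
have X0 : 0 < X by apply: lt_le_trans X1.
have [A0'|Apos] := eqVneq A 0.
  have nE : n = 0 by nia.
  have C1 : 1 <= C by lia.
  have rC1 : (1 : R) <= C%:~R by rewrite -[1]/(1%:~R) ler_int.
  rewrite A0' nE mulr0 add0r !mul0r !add0r => D0 TD.
  have X1' : 1 < X.
    by apply: le_lt_trans rC1 _; rewrite -[ltRHS]mul1r -ltr_pdivrMr //; lra.
  split => //; apply: (form_bound_aux ltr01 x0 T0 _ _ TD); last first.
    by rewrite mul1r lerD2l ler_peMl // invr_ge0 ltW.
  by rewrite mulr1 lerD2l lerN2 ler_peMl // invr_ge0 ltW.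
have A1 : 1 <= A by lia.
(* Up to sign, the roots of the form are n / A and (n + 1) / A. *)
set r := n%:~R : R; set a := A%:~R : R; set c := C%:~R : R.
have -> : (2 * n + 1)%:~R = 2 * r + 1 :> R by rewrite rmorphD rmorphM.
have rAC : r * (r + 1) = a * c.
  by rewrite /r /a /c -intrM -nAC rmorphM rmorphD.
have a1 : 1 <= a by rewrite -[1]/(1%:~R) ler_int.
have r0 : 0 <= r by rewrite -[0]/(0%:~R) ler_int.
have a0 : 0 < a by apply: lt_le_trans a1.
move=> D0 TD.
have DE : X * (2 * r + 1 - (a * X + c / X)) = (2 * r + 1) * X - a * X ^+ 2 - c.
  by field; rewrite gt_eqF.
have fE : a * (X * (2 * r + 1 - (a * X + c / X))) = (a * X - r) * (r + 1 - a * X).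
  rewrite DE; transitivity (a * ((2 * r + 1) * X - a * X ^+ 2) - r * (r + 1)).
    by rewrite rAC; ring.
  by ring.
have f0 : 0 < (a * X - r) * (r + 1 - a * X) by rewrite -fE !mulr_gt0.
have [h1 h2] : r < a * X /\ a * X < r + 1 by split; nra.
have An : A <= n.
  have : a < r + 1 by apply: le_lt_trans h2; rewrite ler_peMr // ltW.
  by rewrite /a /r -[1]/(1%:~R) -intrD ltr_int; lia.
have ar : a <= r by rewrite ler_int.
have nC : n + 1 <= C by nia.
have rc : r + 1 <= c by rewrite /r /c -[1]/(1%:~R) -intrD ler_int.
have X1' : 1 < X by rewrite -(ltr_pM2l a0) mulr1; lra.
split => //; apply: (@form_bound_aux (r + 1) _ _ _ _ _ _ x0 T0 _ _ TD); first lra.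
  rewrite -(ler_pM2l X0) -(ler_pM2l a0) fE.
  have -> : a * (X * ((1 - X^-1) * (r + 1))) = (a * X - a) * (r + 1).
    by field; rewrite gt_eqF.
  by apply: ler_pM; lra.
have xi : 0 < x^-1 by rewrite invr_gt0.
rewrite mulrDr mulr1.
have : (r + 1) * x^-1 <= c * x^-1 by rewrite ler_wpM2r // ltW.
have : 0 < a * x by rewrite mulr_gt0.
lra.
Qed.

(* Here A x^2 + B x + C vanishes at the ends of a Farey edge, the geodesic with
   ends X and - x crosses that edge, and T is exp of twice the time elapsed
   since it crossed the imaginary axis.  The right-hand bound is the value of T
   for the edge from 1 to oo. *)
Lemma form_bound (A B C : int) (X x T : R) :
  B ^+ 2 = 1 + 4 * A * C -> 1 <= X -> 0 < x -> 1 < T ->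
  B%:~R + (A%:~R * X + C%:~R / X) != 0 ->
  T * (B%:~R + (A%:~R * X + C%:~R / X)) = B%:~R - (A%:~R * x + C%:~R / x) ->
  1 < X /\ 1 <= (1 - X^-1) * (x / (1 + x)) * T.
Proof.
move=> disc X1 x0 T1.
have X0 : 0 < X by apply: lt_le_trans X1.
(* Negating the form preserves its discriminant and the equation for [T]. *)
wlog D0 : A B C disc / 0 < B%:~R + (A%:~R * X + C%:~R / X) => [H|_].
  rewrite neq_lt => /orP[Dn|Dp] E; last by apply: (H A B C); rewrite ?gt_eqF.
  apply: (H (- A) (- B) (- C)); rewrite ?sqrrN //.
  - by rewrite disc; ring.
  - rewrite !rmorphN /=; lra.
  - rewrite !rmorphN /= gt_eqF //; lra.
  by rewrite !rmorphN /= !mulNr -!opprD mulrN E; ring.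
move=> E.
have T0 : 0 < T by lra.
(* The discriminant only gives 4 A C >= -1; integrality does the rest. *)
have AC0 : 0 <= A * C by nia.
have ND : B%:~R + (A%:~R * X + C%:~R / X) < B%:~R - (A%:~R * x + C%:~R / x).
  by rewrite -E ltr_pMl.
(* Nonnegative outer coefficients would make the left side of [ND] at least [B] and the right side
   at most [B]. *)
have neg : ~ (0 <= A /\ 0 <= C).
  move=> [A0 C0].
  have a0 : (0 : R) <= A%:~R by rewrite -[0]/(0%:~R) ler_int.
  have c0 : (0 : R) <= C%:~R by rewrite -[0]/(0%:~R) ler_int.
  have : 0 <= A%:~R * X by rewrite mulr_ge0 // ltW.
  have : 0 <= A%:~R * x by rewrite mulr_ge0 // ltW.
  have : 0 <= C%:~R / X by rewrite divr_ge0 // ltW.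
  have : 0 <= C%:~R / x by rewrite divr_ge0 // ltW.
  lra.
have [A0 C0] : A <= 0 /\ C <= 0 by split; nia.
have B0 : 0 < B.
  have a0 : (A%:~R : R) <= 0 by rewrite -[0]/(0%:~R) ler_int.
  have c0 : (C%:~R : R) <= 0 by rewrite -[0]/(0%:~R) ler_int.
  have : A%:~R * X <= 0 by rewrite mulr_le0_ge0 // ltW.
  have : C%:~R / X <= 0 by rewrite mulr_le0_ge0 // invr_ge0 ltW.
  rewrite -(ltr_int R) => ? ?; rewrite -[0%:~R]/0; lra.
have [n Bn] : exists n : int, B = 2 * n + 1.
  exists (B %/ 2)%Z.
  have := divz_eq B 2.
  have : ((B %% 2) = 0 \/ (B %% 2) = 1)%Z.
    have := modz_ge0 B (isT : 2 != 0 :> int).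
    have := ltz_pmod B (isT : 0 < 2 :> int); lia.
  by case=> ->; nia.
move: disc D0 E ND B0; rewrite Bn => disc D0 E _ B0.
apply: (@form_bound_reduced n (- A) (- C) X x T) => //; try nia.
- rewrite !rmorphN /=; lra.
rewrite !rmorphN /= -{2}[C%:~R]opprK -{2}[A%:~R]opprK.
transitivity (T * ((2 * n + 1)%:~R + (A%:~R * X + C%:~R / X))); first by ring.
rewrite E; ring.
Qed.

End FormBound.

(** * The coordinates (U, W, epsilon) on lifted vectors *)

Section Coordinates.
Variable R : realType.
Implicit Types (A B : 'M[R]_2) (p : T1H R) (q : R * R * int) (U W : R) (e : int).

Lemma sign_sqr e : e = 1 \/ e = -1 -> e%:~R * e%:~R = 1 :> R.
Proof. by case=> ->; rewrite ?intrN ?mulrNN mulr1. Qed.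

Lemma sign_neq0 e : e = 1 \/ e = -1 -> e%:~R != 0 :> R.
Proof. by case=> ->; rewrite ?intrN ?oppr_eq0 oner_eq0. Qed.

(* The entries of a frame read off from the coordinates of its vector:
   beta = A00 / A10 = e / U and alpha = A01 / A11 = - e (1 / W - 1). *)
Lemma XliftE p A U W e : frame p A -> (Xlift p /\ coords p = (U, W, e)) <->
  [/\ box (U, W, e), A 1 0 != 0 /\ A 1 1 != 0, A 0 0 = e%:~R / U * A 1 0,
      A 0 1 = - e%:~R * (W^-1 - 1) * A 1 1 &
      A 1 0 ^+ 2 / U = A 1 1 ^+ 2 * (W^-1 - 1)].
Proof.
move=> pA; split=> [[/(XliftP pA)[h b0 c0 d0 ca]]|].
  rewrite (coords_frame pA c0 d0) => -[UE WE eE].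
  have a0 : A 0 0 != 0 by rewrite -normr_gt0 (lt_le_trans _ ca) ?normr_gt0.
  have be0 : A 0 0 / A 1 0 != 0 by rewrite mulf_neq0 ?invr_neq0.
  have al0 : A 0 1 / A 1 1 != 0 by rewrite mulf_neq0 ?invr_neq0.
  (* A base point on the imaginary axis forces alpha and beta to have opposite signs, so epsilon
     determines both. *)
  have alE : A 0 1 / A 1 1 = - (A 0 0 / A 1 0) * (A 1 0 / A 1 1) ^+ 2.
    have -> : A 0 0 = - (A 0 1 * A 1 1) / A 1 0.
      by apply: (mulIf c0); rewrite divfK //; lra.
    by field; rewrite c0 d0.
  have e1 : e = 1 \/ e = -1.
    by rewrite -eE; case: sgzP be0 => //; [left | right].
  have nal : W^-1 - 1 = `|A 0 1 / A 1 1| by rewrite -WE invrK addrC addKr.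
  have W1 : 0 < W < 1.
    rewrite -WE invr_gt0 invf_lt1; first by rewrite ltrDl addr_gt0 ?normr_gt0.
    by rewrite addr_gt0 ?normr_gt0.
  have U1 : 0 < U <= 1.
    rewrite -UE invr_gt0 normr_gt0 be0 invf_le1 ?normr_gt0 //.
    by rewrite normf_div ler_pdivlMr ?normr_gt0 // mul1r.
  have UV : U^-1 = `|A 0 0 / A 1 0| by rewrite -UE invrK.
  have aE : A 0 0 / A 1 0 = e%:~R / U by rewrite UV -eE -sgrEz -numEsg.
  have bE : A 0 1 / A 1 1 = - e%:~R * (W^-1 - 1).
    rewrite nal alE normrM normrN -UV aE.
    by rewrite (ger0_norm (sqr_ge0 _)); ring.
  have aE' : A 0 0 = e%:~R / U * A 1 0 by rewrite -aE divfK.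
  have bE' : A 0 1 = - e%:~R * (W^-1 - 1) * A 1 1 by rewrite -bE divfK.
  split => //.
  move: h; rewrite aE' bE'; case: e1 => ->.
    by move=> h; apply/eqP; rewrite -subr_eq0 -h; apply/eqP; ring.
  by rewrite intrN => h; apply/eqP; rewrite -subr_eq0 -oppr_eq0 -h; apply/eqP; ring.
case=> -[/= /andP[U0 U1] /andP[W0 W1] e1] [c0 d0] aE bE h.
have x0 : 0 < W^-1 - 1 by rewrite subr_gt0 invf_gt1.
have ne : `|e%:~R| = 1 :> R by case: e1 => ->; rewrite ?intrN ?normrN normr1.
have se : sgz (e%:~R : R) = e by case: e1 => ->; rewrite ?intrN ?sgzN sgz1.
have e0 : e%:~R != 0 :> R by rewrite -normr_gt0 ne.
split.
  apply/(XliftP pA); split => //.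
  - rewrite aE bE; transitivity (e%:~R * (A 1 0 ^+ 2 / U - A 1 1 ^+ 2 * (W^-1 - 1))).
      ring.
    by rewrite h subrr mulr0.
  - by rewrite bE !mulf_neq0 ?oppr_eq0 ?(gt_eqF x0).
  rewrite aE !normrM ne mul1r normfV (gtr0_norm U0) ler_peMl //.
  by rewrite invf_ge1.
rewrite (coords_frame pA c0 d0) aE bE !mulfK // !normrM normrN ne !mul1r normfV.
rewrite (gtr0_norm U0) (gtr0_norm x0) invrK addrC subrK invrK sgzM se.
by rewrite (gtr0_sgz _) ?invr_gt0 // mulr1.
Qed.

Lemma XliftEx p : Xlift p -> exists A U W e,
  [/\ frame p A, coords p = (U, W, e), box (U, W, e) & A 1 0 != 0 /\ A 1 1 != 0] /\
  [/\ A 0 0 = e%:~R / U * A 1 0, A 0 1 = - e%:~R * (W^-1 - 1) * A 1 1 &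
      A 1 0 ^+ 2 / U = A 1 1 ^+ 2 * (W^-1 - 1)].
Proof.
move=> Xp; have [A pA] := frame_exists p.
case E : (coords p) => [[U W] e].
have [] := proj1 (XliftE U W e pA) (conj Xp E).
by exists A, U, W, e.
Qed.

Lemma coords_box p : Xlift p -> box (coords p).
Proof. by move=> /XliftEx[A [U [W [e [[_ -> ? _] _]]]]]. Qed.

(** The coordinates give the column ratios and (A10 / A11)^2, and determinant 1 gives A10 A11. Hence
    the frame is known up to sign, which does not affect the vector. *)
Lemma coords_inj p p' : Xlift p -> Xlift p' -> coords p = coords p' -> p = p'.
Proof.
move=> /XliftEx[A [U [W [e [[pA E /= bx [c0 d0]] [aE bE h]]]]]] Xp' E'.
have [A' pA'] := frame_exists p'.
have [] := proj1 (XliftE U W e pA') (conj Xp' (etrans (esym E') E)).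
move=> _ [c0' d0'] aE' bE' h'.
case: bx => /= /andP[U0 _] /andP[W0 W1] e1.
have x0 : 0 < W^-1 - 1 by rewrite subr_gt0 invf_gt1.
have [dA _] := pA; have [dA' _] := pA'.
(* This is beta - alpha; the determinant equals (beta - alpha) A10 A11. *)
pose k := e%:~R * (U^-1 + (W^-1 - 1)).
have k1 : k * (A 1 0 * A 1 1) = 1 by rewrite -dA det_mx2 aE bE /k; ring.
have k1' : k * (A' 1 0 * A' 1 1) = 1 by rewrite -dA' det_mx2 aE' bE' /k; ring.
have cd : A 1 0 * A 1 1 = A' 1 0 * A' 1 1.
  have k0 : k != 0.
    by apply: contra_eq_neq k1 => ->; rewrite mul0r eq_sym oner_eq0.
  by apply: (mulfI k0); rewrite k1.
have cE : A 1 0 ^+ 2 = A 1 1 ^+ 2 * (U * (W^-1 - 1)).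
  by rewrite mulrCA -h mulrCA mulfV ?gt_eqF ?mulr1.
have cE' : A' 1 0 ^+ 2 = A' 1 1 ^+ 2 * (U * (W^-1 - 1)).
  by rewrite mulrCA -h' mulrCA mulfV ?gt_eqF ?mulr1.
have : A' 1 0 ^+ 2 == A 1 0 ^+ 2.
  have : (A' 1 0 ^+ 2) ^+ 2 == (A 1 0 ^+ 2) ^+ 2.
    have -> : (A 1 0 ^+ 2) ^+ 2 = (A 1 0 * A 1 1) ^+ 2 * (U * (W^-1 - 1)).
      by rewrite [LHS]expr2 {2}cE; ring.
    by rewrite [X in X == _]expr2 {2}cE' cd; apply/eqP; ring.
  by rewrite eqrXn2 ?sqr_ge0.
rewrite eqf_sqr => /orP[] /eqP c'E.
  have d'E : A' 1 1 = A 1 1 by apply: (mulfI c0'); rewrite -cd c'E.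
  have AE : A' = A by apply: eq_mx2; rewrite ?aE ?aE' ?bE ?bE' ?c'E ?d'E.
  by apply: frame_inj pA _; rewrite -AE.
have d'E : A' 1 1 = - A 1 1.
  by apply: (mulfI c0'); rewrite -cd c'E mulrNN.
have AE : A' = - A.
  by apply: eq_mx2; rewrite [RHS]mxE ?aE ?aE' ?bE ?bE' ?c'E ?d'E ?mulrN.
by apply: frame_inj pA _; split => //; case: pA' => _ ->; rewrite AE mobiusN.
Qed.

Lemma coords_surj q : box q -> exists2 p, Xlift p & coords p = q.
Proof.
case: q => [[U W] e] bx; case: (bx) => /= /andP[U0 _] /andP[W0 W1] e1.
have x0 : 0 < W^-1 - 1 by rewrite subr_gt0 invf_gt1.
(* The ratio A10 / A11 is to be epsilon r, as the last condition of [XliftE] demands; [l] below is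
   A11, chosen to normalize the determinant. *)
pose r : R := Num.sqrt (U * (W^-1 - 1)).
have r0 : 0 < r by rewrite sqrtr_gt0 mulr_gt0.
have r2 : r ^+ 2 = U * (W^-1 - 1) by rewrite sqr_sqrtr // ltW // mulr_gt0.
have s0 : 0 < r * (U^-1 + (W^-1 - 1)) by rewrite mulr_gt0 // addr_gt0 ?invr_gt0.
pose l : R := (Num.sqrt (r * (U^-1 + (W^-1 - 1))))^-1.
have l0 : 0 < l by rewrite invr_gt0 sqrtr_gt0.
have l2 : l ^+ 2 * (r * (U^-1 + (W^-1 - 1))) = 1.
  by rewrite exprVn sqr_sqrtr ?mulVf ?gt_eqF // ltW.
have ee := sign_sqr e1; have e0 := sign_neq0 e1.
pose c := e%:~R * r * l.
have [|p pA] := @frame_ex R (mx2 (e%:~R / U * c) (- e%:~R * (W^-1 - 1) * l) c l).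
  rewrite det_mx2 !mx2E /c.
  transitivity ((e%:~R * e%:~R) * (l ^+ 2 * (r * (U^-1 + (W^-1 - 1))))).
    ring.
  by rewrite ee mul1r l2.
suff [? ?] : Xlift p /\ coords p = (U, W, e) by exists p.
apply/(XliftE U W e pA).
rewrite !mx2E; split => //.
  by rewrite /c !mulf_neq0 ?(gt_eqF r0) ?(gt_eqF l0).
by rewrite /c !exprMn r2 expr2 ee mul1r; field; rewrite !gt_eqF.
Qed.

Lemma coords_bij : set_bij (@Xlift R) box (@coords R).
Proof.
split; first by move=> p; exact: coords_box.
  by move=> p p' /set_mem ? /set_mem ?; exact: coords_inj.
by move=> q /coords_surj[p Xp pq]; exists p.
Qed.

(** * Coordinates on the quotient by the modular group *)

Lemma T1M_classP p p' : T1M_class p = T1M_class p' <-> modular_rel p p'.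
Proof. by split=> [/eqmodP|] // h; exact/eqmodP. Qed.

Lemma Theta_coords p : Xlift p -> Theta (coords p) = T1M_class p.
Proof.
move=> Xp; rewrite /Theta; case: xgetP => [p' _ [Xp' E]|/(_ p)[]//].
by rewrite (coords_inj Xp' Xp E).
Qed.

Lemma Theta_ex q : box q -> exists2 p, Xlift p & coords p = q /\ Theta q = T1M_class p.
Proof.
by move=> /coords_surj[p Xp <-]; exists p; rewrite // Theta_coords.
Qed.

Lemma XbarE (x : T1M R) : Xbar x <-> exists2 q, box q & x = Theta q.
Proof.
split=> [[p Xp <-]|[q /Theta_ex[p Xp [_ ->]] ->]]; last by exists p.
by exists (coords p); [exact: coords_box | rewrite Theta_coords].
Qed.

(* A vector with |beta| = 1 has a second lift, its image under z |-> -1/z. *)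
Lemma coords_swap p p' A W e : frame p A -> Xlift p -> coords p = (1, W, e) ->
  frame p' (map_mx intr (mx2 0 (-1) 1 0 : 'M[int]_2) *m A) ->
  Xlift p' /\ coords p' = (1, 1 - W, - e).
Proof.
move=> pA Xp E pA'.
have [bx [c0 d0] aE bE h] := proj1 (XliftE _ _ _ pA) (conj Xp E).
case: bx => /= _ /andP[W0 W1] e1.
have W1' : 0 < 1 - W by rewrite subr_gt0.
have ee := sign_sqr e1; have e0 := sign_neq0 e1.
apply/(XliftE _ _ _ pA'); rewrite !mulmx2E !mxE /= !mul0r !mul1r !addr0 !add0r.
rewrite !intrN !mulN1r aE bE; split.
- split => /=; rewrite ?lexx ?ltr01 //; first by rewrite W1' gtrBl.
  by case: e1 => ->; [right | left].
- rewrite !mulf_neq0 ?oppr_eq0 ?invr_neq0 ?oner_eq0 //.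
  by rewrite gt_eqF // subr_gt0 invf_gt1.
- by rewrite !divr1 mulNr mulrA ee mul1r.
- rewrite opprK -!mulrA; set y := A 1 1.
  transitivity (- ((e%:~R * e%:~R) * y)); first by rewrite ee mul1r.
  by field; rewrite (gt_eqF W1') gt_eqF.
rewrite !divr1 in h *.
rewrite exprMn h !exprMn sqrrN expr2 ee !mul1r.
by field; rewrite (gt_eqF W1') gt_eqF.
Qed.

Lemma Theta_swap W e : box (1, W, e) -> Theta (1, 1 - W, - e) = Theta (1, W, e).
Proof.
move=> bx; have [p Xp [E ->]] := Theta_ex bx.
have [A pA] := frame_exists p; have [dA _] := pA.
pose S : 'M[int]_2 := mx2 0 (-1) 1 0.
have dS : \det S = 1 by rewrite det_mx2 !mx2E.
have [|p' pA'] := @frame_ex R (map_mx intr S *m A).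
  by rewrite det_mulmx det_map_mx dS dA mulr1.
have [Xp' <-] := coords_swap pA Xp E pA'.
rewrite (Theta_coords Xp'); apply/T1M_classP; rewrite modular_sym.
by apply/(frame_modular _ pA); exists S.
Qed.

Lemma mulz_eq1 (m n : int) : m * n = 1 -> (m = 1 /\ n = 1) \/ (m = -1 /\ n = -1).
Proof.
by move=> mn; have /orP[/eqP nE|/eqP nE] := intUnitRing.unitzPl mn; lia.
Qed.

(* An element of SL2(Z) mapping a point of the imaginary axis to the imaginary
   axis is 1 or z |-> -1/z, up to sign. *)
Lemma axis_stabilizer (M : 'M[int]_2) A : \det M = 1 -> \det A = 1 ->
  A 0 0 * A 1 0 + A 0 1 * A 1 1 = 0 ->
  let B := map_mx intr M *m A in B 0 0 * B 1 0 + B 0 1 * B 1 1 = 0 ->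
  [\/ M = 1%:M, M = - 1%:M, M = mx2 0 (-1) 1 0 | M = - mx2 0 (-1) 1 0].
Proof.
rewrite !det_mx2 => dM dA h /=; rewrite !mulmx2E !mxE => h'.
(* Expanding [h'] also produces a multiple of the left side of [h], which vanishes. *)
have : (M 0 0 * M 1 0)%:~R * (A 0 0 ^+ 2 + A 0 1 ^+ 2) +
       (M 0 1 * M 1 1)%:~R * (A 1 0 ^+ 2 + A 1 1 ^+ 2) = 0 :> R.
  rewrite -[RHS]h' -[LHS]addr0.
  rewrite -[X in _ + X = _](mulr0 ((M 0 0 * M 1 1 + M 0 1 * M 1 0)%:~R)) -h.
  by rewrite !(rmorphD, rmorphM) /=; ring.
have s1 : 0 < A 0 0 ^+ 2 + A 0 1 ^+ 2.
  rewrite lt0r addr_ge0 ?sqr_ge0 // andbT paddr_eq0 ?sqr_ge0 // !sqrf_eq0.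
  apply/negP => /andP[/eqP a0 /eqP b0]; move: dA; rewrite a0 b0 !mul0r subrr.
  by move=> /eqP; rewrite eq_sym oner_eq0.
have s2 : 0 < A 1 0 ^+ 2 + A 1 1 ^+ 2.
  rewrite lt0r addr_ge0 ?sqr_ge0 // andbT paddr_eq0 ?sqr_ge0 // !sqrf_eq0.
  apply/negP => /andP[/eqP a0 /eqP b0]; move: dA; rewrite a0 b0 !mulr0 subrr.
  by move=> /eqP; rewrite eq_sym oner_eq0.
set P := M 0 0 * M 1 0; set Q := M 0 1 * M 1 1 => PQ0.
(* By determinant 1, P Q has the form j (j + 1) with j an integer. Since P and Q weighted by
   positive numbers sum to zero, both must vanish. *)
have PQ : 0 <= P * Q.
  have mlE : M 0 0 * M 1 1 = M 0 1 * M 1 0 + 1 by rewrite -dM; ring.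
  have -> : P * Q = M 0 0 * M 1 1 * (M 0 1 * M 1 0) by rewrite /P /Q; ring.
  by rewrite mlE; nia.
have [P0 Q0] : P = 0 /\ Q = 0.
  have [Pn|Pp|P0] := ltgtP P 0.
  - have Q0 : Q <= 0 by nia.
    have Pn' : P%:~R * (A 0 0 ^+ 2 + A 0 1 ^+ 2) < 0 by rewrite nmulr_rlt0 // ltrz0.
    have Qn' : Q%:~R * (A 1 0 ^+ 2 + A 1 1 ^+ 2) <= 0.
      by rewrite mulr_le0_ge0 ?lerz0 // ltW.
    by have := ltr_leD Pn' Qn'; rewrite PQ0 addr0 ltxx.
  - have Q0 : 0 <= Q by nia.
    have Pp' : 0 < P%:~R * (A 0 0 ^+ 2 + A 0 1 ^+ 2) by rewrite mulr_gt0 // ltr0z.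
    have Qp' : 0 <= Q%:~R * (A 1 0 ^+ 2 + A 1 1 ^+ 2).
      by rewrite mulr_ge0 ?ler0z // ltW.
    by have := ltr_leD Pp' Qp'; rewrite PQ0 addr0 ltxx.
  split => //; move: PQ0; rewrite P0 mul0r add0r => /eqP.
  by rewrite mulf_eq0 (gt_eqF s2) orbF intr_eq0 => /eqP.
move: P0 Q0 => /eqP; rewrite mulf_eq0 => /orP[] /eqP m0 Q0.
  have [[k1 n1]|[k1 n1]] : M 1 0 = 1 /\ - M 0 1 = 1 \/ M 1 0 = -1 /\ - M 0 1 = -1.
  - by apply: mulz_eq1; rewrite -dM m0; ring.
  - by apply: Or43; apply: eq_mx2; rewrite !mxE /=; rewrite /Q in Q0; nia.
  by apply: Or44; apply: eq_mx2; rewrite !mxE /=; rewrite /Q in Q0; nia.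
have [[k1 n1]|[k1 n1]] : M 0 0 = 1 /\ M 1 1 = 1 \/ M 0 0 = -1 /\ M 1 1 = -1.
- by apply: mulz_eq1; rewrite -dM m0; ring.
- by apply: Or41; apply: eq_mx2; rewrite !mxE /=; rewrite /Q in Q0; nia.
by apply: Or42; apply: eq_mx2; rewrite !mxE /=; rewrite /Q in Q0; nia.
Qed.

Lemma frameN p A : frame p (- A) -> frame p A.
Proof.
by move=> [dA zA]; split; [rewrite -dA !det_mx2 !mxE !mulrNN | rewrite zA mobiusN].
Qed.

(** By [axis_stabilizer], two lifts of one point agree or are exchanged by z |-> -1/z. The latter
    inverts |beta|, and |beta| >= 1 for both lifts leaves only |beta| = 1. *)
Lemma Theta_eq q q' : box q -> box q' -> Theta q = Theta q' ->
  q' = q \/ q.1.1 = 1 /\ q' = (1, 1 - q.1.2, - q.2).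
Proof.
move=> bx /Theta_ex[p' Xp' [<- ->]]; move: bx.
move=> /Theta_ex[p Xp [<- ->]] /T1M_classP.
have [A pA] := frame_exists p; have [dA _] := pA.
move=> /(frame_modular _ pA)[M dM pA'].
have [h b0 c0 d0 ca] := proj1 (XliftP pA) Xp.
have [h' _ _ _ ca'] := proj1 (XliftP pA') Xp'.
suff [->|pS] : p' = p \/ frame p' (map_mx intr (mx2 0 (-1) 1 0 : 'M[int]_2) *m A).
- by left.
- have [_ _ _ _ caS] := proj1 (XliftP pS) Xp'.
  have ac : `|A 0 0| = `|A 1 0|.
    apply/le_anti; rewrite ca andbT; move: caS.
    by rewrite !mulmx2E !mxE /= !mul0r mul1r addr0 add0r intrN mulN1r normrN.
  case E : (coords p) => [[U W] e] /=.
  have U1 : U = 1.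
    move: E; rewrite (coords_frame pA c0 d0) => -[<- _ _].
    by rewrite normf_div ac divff ?invr1 // normr_eq0.
  by right; split => //; apply: (coords_swap pA Xp _ pS).2; rewrite E U1.
have [ME|ME|ME|ME] := axis_stabilizer dM dA h h'; move: pA'; rewrite ME.
- by rewrite map_mx1 mul1mx => pA'; left; exact: frame_inj pA' pA.
- rewrite map_mxN map_mx1 mulNmx mul1mx => /frameN pA'; left.
  exact: frame_inj pA' pA.
- by right.
by rewrite map_mxN mulNmx => /frameN; right.
Qed.

Lemma coordsM_Theta q : box q -> (q.1.1 = 1 -> q.1.2 < 2^-1) ->
  coordsM (Theta q) = q.
Proof.
move=> bq q1; rewrite /coordsM.
case: xgetP => [q' _ [bq' /esym /(Theta_eq bq bq')]|/(_ q)[]]; last first.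
  by split => // /q1 /ltW.
case=> // -[q11 ->] /(_ erefl) /= h; exfalso.
by move: h (q1 q11); move: q.1.2 => W; lra.
Qed.

Lemma coordsM_Xbar (x : T1M R) : Xbar x -> box (coordsM x) /\ Theta (coordsM x) = x.
Proof.
move=> /XbarE[q bq ->]; rewrite /coordsM; case: xgetP => [q' _ []//|H].
have {}H q' : box q' -> Theta q' = Theta q -> (q'.1.1 = 1 -> q'.1.2 <= 2^-1) -> False.
  by move=> b' t' u'; apply: (H q').
case: q bq H => [[U W] e] bq H; exfalso.
have [W2|W2] := leP W 2^-1; first by apply: (H _ bq).
have [U1|U1] := eqVneq U 1; last by apply: (H _ bq) => //= /eqP; rewrite (negPf U1).
(* When U = 1 and W > 1/2, the admissible triple is that of the other lift. *)
rewrite U1 in bq H; apply: (H (1, 1 - W, - e)); last by move=> _ /=; lra.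
  case: bq => /= _ /andP[W0 W1] e1; split; rewrite /= ?ltr01 ?lexx //.
    by rewrite subr_gt0 W1 gtrBl.
  by case: e1 => ->; [right | left].
exact: Theta_swap.
Qed.

End Coordinates.

(** * Lower bound on return times *)

Section FirstReturn.
Variable R : realType.
Implicit Types (A : 'M[R]_2) (p : T1H R) (q : R * R * int) (s U W : R) (e : int).

Lemma flow_modular p p' s : modular_rel p p' -> modular_rel (flow s p) (flow s p').
Proof.
have [A pA] := frame_exists p.
move=> /(frame_modular _ pA)[M dM pM]; apply/(frame_modular _ (frame_flow s pA)).
by exists M; rewrite // mulmxA; exact: frame_flow.
Qed.

Lemma flowM_class p s : flowM s (T1M_class p) = T1M_class (flow s p).
Proof.
apply/T1M_classP/flow_modular/T1M_classP.
exact: reprK.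
Qed.

Lemma XbarP p s A : frame p A -> Xbar (flowM s (T1M_class p)) <->
  exists p' (M : 'M[int]_2), [/\ \det M = 1, Xlift p' &
    frame p' (map_mx intr M *m (A *m diag_flow s))].
Proof.
move=> pA; have pAs := frame_flow s pA; rewrite flowM_class; split.
  move=> [p' Xp' /esym/T1M_classP /(frame_modular _ pAs)[M dM p'M]].
  by exists p', M.
move=> [p' [M [dM Xp' p'M]]]; exists p' => //; apply/esym/T1M_classP.
by apply/(frame_modular _ pAs); exists M.
Qed.

Lemma expR_half_sqr s : expR (s / 2) * expR (s / 2) = expR s.
Proof. by rewrite -expRD -splitr. Qed.

Lemma return_time_ge q s : box q -> 0 < s -> Xbar (flowM s (Theta q)) ->
  q.1.1 < 1 /\ 1 <= (1 - q.1.1) * (1 - q.1.2) * expR (s *+ 2).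
Proof.
move=> /Theta_ex[p Xp [<- ->]] s0.
have [A [U [W [e [[pA -> bx [c0 d0]] [aE bE h]]]]]] := XliftEx Xp.
move=> /(XbarP _ pA)[p' [M [dM Xp' p'M]]] /=.
case: bx => /= /andP[U0 U1] /andP[W0 W1] e1.
have ee := sign_sqr R e1; have e0 := sign_neq0 R e1.
have x0 : 0 < W^-1 - 1 by rewrite subr_gt0 invf_gt1.
have [h' _ c'0 _ ca'] := proj1 (XliftP p'M) Xp'.
have a'0 : (map_mx intr M *m (A *m diag_flow s)) 0 0 != 0.
  by rewrite -normr_gt0 (lt_le_trans _ ca') ?normr_gt0.
move: h' a'0 c'0; rewrite !mulmx2E !mxE /= => h' a'0 c'0.
set m := M 0 0 in h' a'0 c'0; set n := M 0 1 in h' a'0 c'0.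
set k := M 1 0 in h' a'0 c'0; set l := M 1 1 in h' a'0 c'0.
set u := expR (s / 2) in h' a'0 c'0; set v := expR (- (s / 2)) in h'.
have u0 : 0 < u by exact: expR_gt0.
have uv : u * v = 1 by rewrite /u /v -expRD subrr expR0.
pose X := U^-1; pose x := W^-1 - 1.
have X1 : 1 <= X by rewrite invf_ge1.
have X0 : 0 < X by rewrite invr_gt0.
(* For f(y) = (m y + n)(k y + l), these coefficients give D = epsilon f(beta) / beta and N = epsilon
   f(alpha) / alpha. *)
pose fa : R := (m * k)%:~R; pose fc : R := (n * l)%:~R.
pose fb : R := (e * (m * l + n * k))%:~R.
set D := fb + (fa * X + fc / X); set N := fb - (fa * x + fc / x).
have acE : (m%:~R * (A 0 0 * u + A 0 1 * 0) + n%:~R * (A 1 0 * u + A 1 1 * 0)) *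
    (k%:~R * (A 0 0 * u + A 0 1 * 0) + l%:~R * (A 1 0 * u + A 1 1 * 0)) =
    A 1 0 ^+ 2 * X * u ^+ 2 * D.
  rewrite aE -/X /D /fa /fb /fc !rmorphM rmorphD !rmorphM /=.
  transitivity (A 1 0 ^+ 2 * u ^+ 2 * (m%:~R * k%:~R * X ^+ 2 * (e%:~R * e%:~R) +
    e%:~R * (m%:~R * l%:~R + n%:~R * k%:~R) * X + n%:~R * l%:~R)); first by ring.
  by rewrite ee; field; rewrite gt_eqF.
have bdE : (m%:~R * (A 0 0 * 0 + A 0 1 * v) + n%:~R * (A 1 0 * 0 + A 1 1 * v)) *
    (k%:~R * (A 0 0 * 0 + A 0 1 * v) + l%:~R * (A 1 0 * 0 + A 1 1 * v)) =
    - (A 1 1 ^+ 2 * x * v ^+ 2 * N).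
  rewrite bE -/x /N /fa /fb /fc !rmorphM rmorphD !rmorphM /=.
  transitivity (A 1 1 ^+ 2 * v ^+ 2 * (m%:~R * k%:~R * x ^+ 2 * (e%:~R * e%:~R) -
    e%:~R * (m%:~R * l%:~R + n%:~R * k%:~R) * x + n%:~R * l%:~R)); first by ring.
  by rewrite ee; field; rewrite gt_eqF.
have D0 : D != 0.
  by move: (mulf_neq0 a'0 c'0); rewrite acE; apply: contra => /eqP ->; rewrite mulr0.
have E : expR (s *+ 2) * D = N.
  have dx0 : A 1 1 ^+ 2 * x != 0 by rewrite mulf_neq0 ?sqrf_eq0 // gt_eqF.
  (* The condition [h'] says that the vector at time [s] sits on the edge; the common factor is
     removed using [h], the same condition at time 0. *)
  have uDvN : u ^+ 2 * D = v ^+ 2 * N.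
    apply: (mulfI dx0); apply/eqP; rewrite -subr_eq0 -h' acE bdE -h -/X.
    by apply/eqP; ring.
  have -> : expR (s *+ 2) = u ^+ 2 * u ^+ 2.
    by rewrite /u expr2 expR_half_sqr -expRD mulr2n.
  rewrite -mulrA uDvN; transitivity ((u * v) ^+ 2 * N); first by ring.
  by rewrite uv expr1n mul1r.
have T1 : 1 < expR (s *+ 2) by rewrite expR_gt1 pmulrn_lgt0.
have disc : (e * (m * l + n * k)) ^+ 2 = 1 + 4 * (m * k) * (n * l).
  move: dM; rewrite det_mx2 -/m -/n -/k -/l => dM.
  transitivity ((m * l - n * k) ^+ 2 + 4 * (m * k) * (n * l)); last by rewrite dM.
  rewrite exprMn; have -> : e ^+ 2 = 1 by case: e1 => ->.
  by ring.
have [] := form_bound disc X1 x0 T1 D0 E.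
rewrite /X invrK invf_gt1 // => U1' H; split => //.
have <- : x / (1 + x) = 1 - W by rewrite /x [1 + _]addrC subrK invrK mulrBl mul1r mulVf ?gt_eqF.
exact: H.
Qed.

(** * The bound is attained, and the return map *)

Definition return_time U W : R := - 2^-1 * ln ((1 - U) * (1 - W)).

Lemma expR_return_time U W : U < 1 -> W < 1 ->
  expR (return_time U W *+ 2) = ((1 - U) * (1 - W))^-1.
Proof.
move=> U1 W1; have UW : 0 < (1 - U) * (1 - W) by rewrite mulr_gt0 ?subr_gt0.
have -> : return_time U W *+ 2 = - ln ((1 - U) * (1 - W)).
  by rewrite /return_time -mulr_natr; field.
by rewrite expRN lnK.
Qed.

Lemma return_time_gt0 U W : 0 < U < 1 -> 0 < W < 1 -> 0 < return_time U W.
Proof.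
move=> /andP[U0 U1] /andP[W0 W1].
have h : 1 < expR (return_time U W *+ 2).
  rewrite expR_return_time // invf_gt1 ?mulr_gt0 ?subr_gt0 //.
  by rewrite mulr_ilt1 ?subr_ge0 ?(ltW U1) ?(ltW W1) // gtrBl.
by move: h; rewrite expR_gt1 pmulrn_lgt0.
Qed.

Definition return_coords U W e : R * R * int :=
  (Ftilde (U, W), if U <= 2^-1 then e else - e).

Lemma box_return_coords U W e : box_star (U, W, e) -> box (return_coords U W e).
Proof.
move=> [[/= /andP[U0 _] /andP[W0 W1] e1] U1].
have eN1 : - e = 1 \/ - e = -1 by case: e1 => ->; [right | left].
rewrite /return_coords /Ftilde /=; case: leP => U2; split => //=.
- by rewrite divr_gt0 ?subr_gt0 // ler_pdivrMr ?subr_gt0 //; lra.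
- by rewrite divr_gt0 ?addr_gt0 // ltr_pdivrMr ?addr_gt0 //; lra.
- by rewrite divr_gt0 ?subr_gt0 // ler_pdivrMr //; lra.
by rewrite divr_gt0 ?addr_gt0 // ltr_pdivrMr ?addr_gt0 //; lra.
Qed.

(* The matrix below takes the first Farey edge met after the imaginary axis,
   from epsilon to oo, back to the imaginary axis. *)
Lemma return_flow U W e : box_star (U, W, e) ->
  flowM (return_time U W) (Theta (U, W, e)) = Theta (return_coords U W e).
Proof.
move=> bs; have bx' := box_return_coords bs.
case: bs => bx U1; have [p Xp [E ->]] := Theta_ex bx.
have [A pA] := frame_exists p; have [dA _] := pA.
have [_ [c0 d0] aE bE h] := proj1 (XliftE _ _ _ pA) (conj Xp E).
case: bx U1 => /= /andP[U0 _] /andP[W0 W1] e1 U1.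
have ee := sign_sqr R e1; have e0 := sign_neq0 R e1.
set r := return_time U W.
have pAr := frame_flow r pA; rewrite flowM_class.
(* Translation by - epsilon turns |beta| into 1/U - 1, which is at least 1 exactly when U <= 1/2;
   otherwise z |-> -1/z follows and flips the sign of beta. *)
pose M : 'M[int]_2 := if U <= 2^-1 then mx2 1 (- e) 0 1 else mx2 0 (-1) 1 (- e).
have dM : \det M = 1 by rewrite /M; case: ifP => _; rewrite det_mx2 !mx2E; ring.
have [|p' p'M] := @frame_ex R (map_mx intr M *m (A *m diag_flow r)).
  by rewrite !det_mulmx det_map_mx dM dA det_diag_flow !mulr1.
suff [Xp' <-] : Xlift p' /\ coords p' = return_coords U W e.
  rewrite (Theta_coords Xp'); apply/T1M_classP/(frame_modular _ pAr).
  by exists M.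
have u0 : 0 < expR (r / 2) by exact: expR_gt0.
have v0 : 0 < expR (- (r / 2)) by exact: expR_gt0.
have uE : expR (r / 2) ^+ 2 * ((1 - U) * (1 - W)) = expR (- (r / 2)) ^+ 2.
  apply: (mulfI (lt0r_neq0 (exprn_gt0 2 u0))).
  rewrite -exprMn -expRD subrr expR0 expr1n mulrA expr2 expR_half_sqr -expRD.
  rewrite -mulr2n expR_return_time // mulVf // mulf_neq0 //.
    by rewrite gt_eqF // subr_gt0.
  by rewrite gt_eqF // subr_gt0.
(* This places the base point at time [r] on the vertical line over epsilon: it is the last
   condition of [XliftE] after the translation. *)
have cuE : A 1 0 ^+ 2 * expR (r / 2) ^+ 2 * (1 - U) / U =
    A 1 1 ^+ 2 * expR (- (r / 2)) ^+ 2 / W.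
  rewrite -uE; transitivity (A 1 0 ^+ 2 / U * (expR (r / 2) ^+ 2 * (1 - U))).
    by ring.
  by rewrite h; field; rewrite gt_eqF.
have U1' : 1 - U != 0 by rewrite gt_eqF // subr_gt0.
have U0' : U != 0 by rewrite gt_eqF.
have W0' : W != 0 by rewrite gt_eqF.
have W1' : 1 + W != 0 by rewrite gt_eqF // addr_gt0.
move: p'M bx'; rewrite /M /return_coords /Ftilde /=.
case: leP => U2 p'M bx'; apply/(XliftE _ _ _ p'M); rewrite !mulmx2E !mxE /=;
  rewrite ?intrN !mulr0 !addr0 !add0r !mul0r ?addr0 ?add0r ?mul1r ?mulN1r aE bE;
  move: (expR (r / 2)) (expR (- (r / 2))) u0 v0 cuE => u v u0 v0 cuE; split => //.
- by rewrite !mulf_neq0 ?(gt_eqF u0) ?(gt_eqF v0).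
- by field; rewrite U0' U1'.
- by field; rewrite W0' W1'.
- rewrite !exprMn; transitivity (A 1 0 ^+ 2 * u ^+ 2 * (1 - U) / U).
    by field; rewrite U0' U1'.
  by rewrite cuE; field; rewrite W0' W1'.
- by move: bx'; rewrite div1r.
- have -> : e%:~R / U * A 1 0 * u + - e%:~R * (A 1 0 * u) =
      e%:~R * ((1 - U) / U * A 1 0 * u) by field.
  have -> : - e%:~R * (W^-1 - 1) * A 1 1 * v + - e%:~R * (A 1 1 * v) =
      - e%:~R * (A 1 1 * v / W) by field.
  by rewrite !mulf_neq0 ?oppr_eq0 ?invr_eq0 ?(gt_eqF u0) ?(gt_eqF v0).
- transitivity (- (e%:~R * e%:~R) * (A 1 0 * u)); first by rewrite ee mulN1r.
  by field; rewrite U0' U1'.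
- transitivity (- (e%:~R * e%:~R) * (A 1 1 * v)); first by rewrite ee mulN1r.
  by field; rewrite W0' W1'.
transitivity (e%:~R * e%:~R * (A 1 0 ^+ 2 * u ^+ 2 * (1 - U) / U)).
  by field; rewrite U0' U1'.
by rewrite cuE; field; rewrite W0' W1'.
Qed.

Lemma first_return_unique (x : T1M R) s s' :
  is_first_return x s -> is_first_return x s' -> s = s'.
Proof.
move=> [s0 Xs sm] [s0' Xs' sm']; apply/le_anti.
by rewrite (sm s') // (sm' s).
Qed.

Lemma first_returnP U W e : box_star (U, W, e) ->
  is_first_return (Theta (U, W, e)) (return_time U W).
Proof.
move=> bs; case: (bs) => bx /= U1; case: (bx) => /= /andP[U0 _] /andP[W0 W1] _.
have UW : 0 < (1 - U) * (1 - W) by rewrite mulr_gt0 ?subr_gt0.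
split; first by rewrite return_time_gt0 ?U0 ?W0.
  by rewrite return_flow //; apply/XbarE; exists (return_coords U W e); rewrite //;
    exact: box_return_coords.
move=> s s0 /(return_time_ge bx s0)[_ /=].
rewrite -ler_pdivrMl // mulr1 -expR_return_time // ler_expR.
by rewrite lerMn2r.
Qed.

Lemma rbarE U W e : box_star (U, W, e) -> rbar (Theta (U, W, e)) = return_time U W.
Proof.
move=> bs; have fr := first_returnP bs; rewrite /rbar.
by case: xgetP => [s _ /first_return_unique/(_ fr)|/(_ _ fr)].
Qed.

Lemma PbarE U W e : box_star (U, W, e) ->
  Pbar (Theta (U, W, e)) = Theta (return_coords U W e).
Proof. by move=> bs; rewrite /Pbar (rbarE bs) return_flow. Qed.

(** The image has first coordinate 1 only for U = 1/2, and then its second coordinate W / (1 + W) is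
    below 1/2, so [coordsM] selects this very triple. *)
Lemma coordsM_PbarE U W e : box_star (U, W, e) ->
  coordsM (Pbar (Theta (U, W, e))) = return_coords U W e.
Proof.
move=> bs; rewrite (PbarE bs); apply: coordsM_Theta; first exact: box_return_coords.
case: bs => -[/= /andP[U0 _] /andP[W0 W1] _] U1.
rewrite /return_coords /Ftilde /=; case: (leP U 2^-1) => U2 /=.
  move=> _; rewrite ltr_pdivrMr ?addr_gt0 //; lra.
move=> /(canRL (divfK (lt0r_neq0 U0))); lra.
Qed.

Lemma coordsM_Theta_star q : box_star q -> coordsM (Theta q) = q.
Proof.
by move=> [bq q1]; apply: coordsM_Theta => // q11; move: q1; rewrite q11 ltxx.
Qed.

(** A vector with U = 1 runs into the cusp at epsilon and never returns: [return_time_ge] yields U <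
    1 from any return. *)
Lemma XstarE : @Xstar R = @Theta R @` box_star.
Proof.
apply/seteqP; split=> [x [/XbarE[q bq ->] [s [s0 Xs _]]]|_ [q bq <-]].
  have [q1 _] := return_time_ge bq s0 Xs.
  by exists q.
case: q bq => [[U W] e] bq; split; first by apply/XbarE; exists (U, W, e) => //; case: bq.
by exists (return_time U W); exact: first_returnP.
Qed.

End FirstReturn.

Theorem theorem3p1 (R : realType) :
  [/\ set_bij (@Xlift R) box (@coords R),
      (forall x : T1M R, Xbar x -> box (coordsM x) /\ Theta (coordsM x) = x) /\
      (forall q : R * R * int, box_star q -> coordsM (Theta q) = q),
      @Xstar R = @Theta R @` box_star,
      (forall (U W : R) (e : int), box_star (U, W, e) ->
        [/\ 0 < U <= 2^-1 ->
              Pbar (Theta (U, W, e)) = Theta (Ftilde (U, W), e) /\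
              coordsM (Pbar (Theta (U, W, e))) = (Ftilde (U, W), e),
            2^-1 < U < 1 ->
              Pbar (Theta (U, W, e)) = Theta (Ftilde (U, W), - e) /\
              coordsM (Pbar (Theta (U, W, e))) = (Ftilde (U, W), - e) &
            rbar (Theta (U, W, e)) = - (2^-1) * ln ((1 - U) * (1 - W))])
    & forall x : T1M R, Xstar x -> piXbar (Pbar x) = Ftilde (piXbar x)].
Proof.
split.
- exact: coords_bij.
- by split; [exact: coordsM_Xbar | exact: coordsM_Theta_star].
- exact: XstarE.
- move=> U W e bs; split; last exact: rbarE.
    by move=> /andP[_ U2]; rewrite coordsM_PbarE // PbarE // /return_coords U2.
  move=> /andP[U2 _]; rewrite coordsM_PbarE // PbarE // /return_coords.
  by rewrite leNgt U2.
rewrite XstarE => _ [[[U W] e] bs <-].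
by rewrite /piXbar coordsM_PbarE // coordsM_Theta_star.
Qed.
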